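(* Let $(\mathfrak{g},[\cdot,\ldots,\cdot],\alpha)$ be a multiplicative $n$-ary Hom-Lie superalgebra such that $\mathfrak{g}=I\oplus J$, where $I$ and $J$ are Hom-ideals of $\mathfrak{g}$, and $\alpha$ is bijective. Regard $I$ and $J$ as multiplicative $n$-ary Hom-Lie superalgebras with the restricted bracket and the restriction of $\alpha$ (also denoted $\alpha$). Then: 1) $C(\mathfrak{g})=C(I)\oplus C(J)$. 2) If $C(\mathfrak{g})=\{0\}$, then for every $k\ge 0$, $$\operatorname{Inn}_{\alpha^k}(\mathfrak{g})=\operatorname{Inn}_{\alpha^k}(I)\oplus\operatorname{Inn}_{\alpha^k}(J),\qquad \operatorname{Der}_{\alpha^{k+1}}(\mathfrak{g})=\operatorname{Der}_{\alpha^{k+1}}(I)\oplus\operatorname{Der}_{\alpha^{k+1}}(J).$$ 3) $\mathfrak{g}$ is complete if and only if both $I$ and $J$ are complete.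
   Context: Vector spaces are over a field $\mathbb{K}$ of characteristic zero, and $n\ge 2$. For a $\mathbb{Z}_2$-graded space $N=N_{\bar 0}\oplus N_{\bar 1}$, $H(N)=N_{\bar 0}\cup N_{\bar 1}$ and $|x|$ is the parity of $x\in H(N)$. A linear map is even if it preserves the grading; an $n$-linear bracket is even if $[N_{\bar k_1},\ldots,N_{\bar k_n}]\subseteq N_{\bar k_1+\cdots+\bar k_n}$. A multiplicative $n$-ary Hom-Nambu superalgebra $(N,[\cdot,\ldots,\cdot],\alpha)$ consists of such an $N$, an even $n$-linear bracket and an even linear map $\alpha:N\to N$ with $\alpha([x_1,\ldots,x_n])=[\alpha(x_1),\ldots,\alpha(x_n)]$, satisfying for homogeneous $x_i,y_j$ $$[\alpha(x_1),\ldots,\alpha(x_{n-1}),[y_1,\ldots,y_n]]=\sum_{i=1}^n(-1)^{|X||Y|_{i-1}}[\alpha(y_1),\ldots,\alpha(y_{i-1}),[x_1,\ldots,x_{n-1},y_i],\alpha(y_{i+1}),\ldots,\alpha(y_n)],$$ where $|X|=\sum_{k=1}^{n-1}|x_k|$, $|Y|_{i-1}=\sum_{k=1}^{i-1}|y_k|$. It is a multiplicative $n$-ary Hom-Lie superalgebra (= multiplicative $n$-Hom-Lie superalgebra) if moreover $[\ldots,x_i,x_{i+1},\ldots]=-(-1)^{|x_i||x_{i+1}|}[\ldots,x_{i+1},x_i,\ldots]$ for homogeneous elements and $1\le i\le n-1$. A Hom-ideal $I$ of $N$ is a graded subspace with $\alpha(I)\subseteq I$, $[I,\ldots,I]\subseteq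 I$ and $[N,\ldots,N,I,N,\ldots,N]\subseteq I$ with $I$ in the $i$-th position, for each $1\le i\le n$. With $\alpha^0=\mathrm{id}$, a homogeneous linear map $D:N\to N$ of parity $|D|$ is an $\alpha^k$-derivation if $D\circ\alpha=\alpha\circ D$ and, for homogeneous $x_i$, $D([x_1,\ldots,x_n])=\sum_{i=1}^n(-1)^{|D|(|x_1|+\cdots+|x_{i-1}|)}[\alpha^k(x_1),\ldots,\alpha^k(x_{i-1}),D(x_i),\alpha^k(x_{i+1}),\ldots,\alpha^k(x_n)]$. $\operatorname{Der}_{\alpha^k}(N)$ is the direct sum of the spaces of even and of odd $\alpha^k$-derivations. For $X=(x_1,\ldots,x_{n-1})\in H(N)^{n-1}$ with $\alpha(x_i)=x_i$ for all $i$, $\operatorname{ad}_X^k(y)=[x_1,\ldots,x_{n-1},\alpha^k(y)]$ is an (inner) $\alpha^{k+1}$-derivation; $\operatorname{Inn}_{\alpha^k}(N)\subseteq\operatorname{Der}_{\alpha^{k+1}}(N)$ is the linear span of all such $\operatorname{ad}_X^k$. The center is $C(N)=\bigcap_{i=1}^nC_i(N)$ with $C_i(N)=\{z\in N:[x_1,\ldots,x_{i-1},z,x_{i+1},\ldots,x_n]=0\ \forall x_j\in N\}$. $C(I)$ and $C(J)$ denote the centers of the algebras $I$ and $J$ themselves. $N$ is complete if $C(N)=\{0\}$ and $\operatorname{Der}_{\alpha^{k+1}}(N)=\operatorname{Inn}_{\alpha^k}(N)$ for every integer $k\ge 0$. In 2), linear maps on $I$ (resp. $J$) are regarded as linear maps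 on $\mathfrak{g}$ by extending them by zero on $J$ (resp. $I$), i.e. $(D_I\oplus D_J)(i+j)=D_I(i)+D_J(j)$ for $i\in I$, $j\in J$. *)

(* Defs.v *)
From HB Require Import structures.
From mathcomp Require Import all_boot all_order all_fingroup all_algebra.
From mathcomp Require Import mathcomp_extra boolp classical_sets functions.

Set Implicit Arguments.
Unset Strict Implicit.
Unset Printing Implicit Defensive.

Import GRing.Theory.

Local Open Scope classical_set_scope.
Local Open Scope ring_scope.

Section LinearAlgebra.
Variables (K : fieldType) (W : lmodType K).

(* W = U (+) V, internally. *)
Definition is_dirsum (S U V : set W) : Prop :=
  S = [set u + v | u in U & v in V] /\ U `&` V = [set 0].

Definition linspan (S : set W) : set W :=
  [set w | exists m (c : 'I_m -> K) (s : 'I_m -> W),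
    (forall i, S (s i)) /\ w = \sum_(i < m) c i *: s i].

End LinearAlgebra.

Section Families.
Variables (K : fieldType) (n : nat) (V : lmodType K).
Implicit Type x : {ffun 'I_n -> V}.

Definition upd x (i : 'I_n) (z : V) : {ffun 'I_n -> V} :=
  [ffun j => if j == i then z else x j].

(* (x_1, ..., x_(n-1), y) *)
Definition append (x : {ffun 'I_n.-1 -> V}) (y : V) : {ffun 'I_n -> V} :=
  [ffun i => oapp x y (insub (val i))].

Definition swap x (i j : 'I_n) : {ffun 'I_n -> V} := [ffun k => x (tperm i j k)].

Definition multilinear (br : {ffun 'I_n -> V} -> V) : Prop :=
  forall x (i : 'I_n) (a : K) (u v : V),
    br (upd x i (a *: u + v)) = a *: br (upd x i u) + br (upd x i v).

(* Parities are booleans, [true] being odd, read as 0 or 1 in exponents. *)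
Definition homog_fam m (gr : bool -> submodClosed V) (p : 'I_m -> bool)
    (x : {ffun 'I_m -> V}) : Prop :=
  forall i, x i \in gr (p i).

Definition par_before (p : 'I_n -> bool) (i : 'I_n) : nat :=
  (\sum_(j < n | (j < i)%N) p j)%N.

End Families.

(* Multiplicative n-ary Hom-Nambu superalgebras.  In the laws, the parities of
   homogeneous elements are universally quantified, [0] being homogeneous of
   both parities (every term of the laws then vanishes).  Subspaces that carry
   structure are boolean [submodClosed] predicates; under the classical logic
   of [boolp] every linear subspace is of this form. *)
Record homNambu (K : fieldType) (n : nat) := HomNambu {
  hn_sort :> lmodType K;
  gr : bool -> submodClosed hn_sort;
  gr_dirsum : is_dirsum [set: hn_sort] [set` gr false] [set` gr true];
  br : {ffun 'I_n -> hn_sort} -> hn_sort;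
  br_multilinear : multilinear br;
  br_even : forall p x, homog_fam gr p x ->
    br x \in gr (odd (\sum_(i < n) p i)%N);
  alpha : {linear hn_sort -> hn_sort};
  alpha_even : forall q u, u \in gr q -> alpha u \in gr q;
  alpha_mult : forall x, alpha (br x) = br [ffun i => alpha (x i)];
  hom_nambu : forall p q (x : {ffun 'I_n.-1 -> hn_sort})
      (y : {ffun 'I_n -> hn_sort}),
    homog_fam gr p x -> homog_fam gr q y ->
    br (append [ffun i => alpha (x i)] (br y)) =
    \sum_(i < n) (-1) ^+ ((\sum_(k < n.-1) p k) * par_before q i)%N *:
      br (upd [ffun j => alpha (y j)] i (br (append x (y i))))
}.

Definition skew_super (K : fieldType) (n : nat) (N : homNambu K n) : Prop :=
  forall p (x : {ffun 'I_n -> N}) (i j : 'I_n),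
    homog_fam (@gr _ _ N) p x -> j = i.+1 :> nat ->
    br x = - ((-1) ^+ (p i * p j)%N *: br (swap x i j)).

Record homLie (K : fieldType) (n : nat) := HomLie {
  hl_sort :> homNambu K n;
  br_skew : skew_super hl_sort
}.

Section Notions.
Variables (K : fieldType) (n : nat) (N : homNambu K n).

Definition center_at (i : 'I_n) : set N :=
  [set z | forall x : {ffun 'I_n -> N}, br (upd x i z) = 0].

Definition center : set N := \bigcap_(i in [set: 'I_n]) center_at i.

Definition has_parity (d : bool) (D : N -> N) : Prop :=
  forall q u, u \in gr N q -> D u \in gr N (d (+) q).

(* The alpha^k-derivations that are homogeneous of parity d. *)
Definition is_derivation (k : nat) (d : bool) (D : N -> N) : Prop :=
  [/\ linear D, has_parity d D,
      forall u, D (alpha N u) = alpha N (D u) &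
      forall p (x : {ffun 'I_n -> N}), homog_fam (gr N) p x ->
        D (br x) = \sum_(i < n) (-1) ^+ (d * par_before p i)%N *:
          br (upd [ffun j => iter k (alpha N) (x j)] i (D (x i)))].

(* The sum is direct: a map that is both even and odd is zero. *)
Definition Der (k : nat) : set (N -> N) :=
  [set D0 + D1 | D0 in is_derivation k false & D1 in is_derivation k true].

Definition ad (k : nat) (x : {ffun 'I_n.-1 -> N}) : N -> N :=
  fun y => br (append x (iter k (alpha N) y)).

(* Inn_(alpha^k), a subspace of Der_(alpha^(k+1)). *)
Definition Inn (k : nat) : set (N -> N) :=
  linspan [set f | exists x : {ffun 'I_n.-1 -> N},
    [/\ forall i, exists q, x i \in gr N q,
        forall i, alpha N (x i) = x i & f = ad k x]].

Definition complete : Prop :=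
  center = [set 0] /\ forall k, Der k.+1 = Inn k.

Record Hom_ideal (I : submodClosed N) : Prop := HomIdeal {
  ideal_graded : forall u, u \in I -> exists u0 u1,
    [/\ u0 \in I, u0 \in gr N false, u1 \in I, u1 \in gr N true & u = u0 + u1];
  ideal_alpha : forall u, u \in I -> alpha N u \in I;
  ideal_br : forall x : {ffun 'I_n -> N}, (forall i, x i \in I) -> br x \in I;
  ideal_absorb : forall (x : {ffun 'I_n -> N}) (i : 'I_n),
    x i \in I -> br x \in I
}.

End Notions.

Arguments center_at {K n} N i _.
Arguments center {K n} N _.
Arguments Der {K n} N k _.
Arguments Inn {K n} N k _.
Arguments complete {K n} N.

Section Subspace.
Variables (K : fieldType) (V : lmodType K) (I : submodClosed V).

Record sub_of := SubOf { sub_val :> V; _ : sub_val \in I }.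

HB.instance Definition _ := [isSub for sub_val].
HB.instance Definition _ := [Choice of sub_of by <:].
HB.instance Definition _ := [SubChoice_isSubLmodule of sub_of by <:].

Lemma sub_valP (u : sub_of) : sub_val u \in I. Proof. exact: valP u. Qed.

Lemma sub_val_is_linear : linear sub_val. Proof. by []. Qed.
HB.instance Definition _ :=
  GRing.isLinear.Build K sub_of V *:%R sub_val sub_val_is_linear.

End Subspace.

(* A Hom-ideal with the restricted grading, bracket and twisting map. *)
Section Restriction.
Variables (K : fieldType) (n : nat) (N : homLie K n) (I : submodClosed N).
Hypothesis hI : Hom_ideal I.

Let sI : lmodType K := sub_of I.

Definition sub_gr_pred (q : bool) : {pred sI} :=
  fun u : sI => sub_val u \in gr N q.

Fact sub_gr_closed q : subsemimod_closed (sub_gr_pred q).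
Proof.
have gD := @rpredD _ (gr N q); have gZ := @rpredZ _ _ (gr N q).
split; [split; [exact: rpred0 | move=> u v; exact: gD] | move=> a u; exact: gZ].
Qed.
HB.instance Definition _ q :=
  GRing.isSubSemiModClosed.Build K sI (sub_gr_pred q) (sub_gr_closed q).

Definition sub_gr (q : bool) : submodClosed sI := sub_gr_pred q.

Definition fam_val m (x : {ffun 'I_m -> sI}) : {ffun 'I_m -> N} :=
  [ffun i => sub_val (x i)].

Fact sub_br_in (x : {ffun 'I_n -> sI}) : br (fam_val x) \in I.
Proof. by apply: (ideal_br hI) => i; rewrite ffunE sub_valP. Qed.

Definition sub_br (x : {ffun 'I_n -> sI}) : sI := SubOf (sub_br_in x).

Definition sub_alpha (u : sI) : sI := SubOf (ideal_alpha hI (sub_valP u)).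

Fact sub_alpha_linear : linear sub_alpha.
Proof. by move=> a u v; apply: val_inj; rewrite /= linearP. Qed.
HB.instance Definition _ :=
  GRing.isLinear.Build K sI sI *:%R sub_alpha sub_alpha_linear.

Fact sub_gr_dirsum : is_dirsum [set: sI] [set` sub_gr false] [set` sub_gr true].
Proof.
have [_ cap0] := gr_dirsum N; split.
  apply/esym/seteqP; split=> // u _.
  have [u0 [u1 [I0 g0 I1 g1 uE]]] := ideal_graded hI (sub_valP u).
  by exists (SubOf I0) => //; exists (SubOf I1) => //; apply: val_inj.
apply/seteqP; split=> [u [/= u0 u1]|_ ->]; last by split; exact: rpred0.
apply: val_inj => /=.
by have /= : [set 0 : N] (sub_val u) by rewrite -cap0.
Qed.

Fact fam_val_upd (x : {ffun 'I_n -> sI}) i u :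
  fam_val (upd x i u) = upd (fam_val x) i (sub_val u).
Proof. by apply/ffunP => j; rewrite !ffunE; case: eqP. Qed.

Fact fam_val_append (x : {ffun 'I_n.-1 -> sI}) u :
  fam_val (append x u) = append (fam_val x) (sub_val u) :> {ffun 'I_n -> N}.
Proof.
by apply/ffunP => j; rewrite !ffunE; case: insub => //= k; rewrite ffunE.
Qed.

Fact fam_val_alpha m (x : {ffun 'I_m -> sI}) :
  fam_val [ffun i => sub_alpha (x i)] = [ffun i => alpha N (fam_val x i)].
Proof. by apply/ffunP => j; rewrite !ffunE. Qed.

Fact fam_val_homog m p (x : {ffun 'I_m -> sI}) :
  homog_fam sub_gr p x -> homog_fam (gr N) p (fam_val x).
Proof. by move=> hx i; rewrite ffunE; exact: hx. Qed.

Fact sub_br_multilinear : multilinear sub_br.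
Proof.
move=> x i a u v; apply: val_inj => /=.
by rewrite !fam_val_upd linearP br_multilinear.
Qed.

Fact sub_br_even p x : homog_fam sub_gr p x ->
  sub_br x \in sub_gr (odd (\sum_(i < n) p i)%N).
Proof. by move=> /fam_val_homog /br_even. Qed.

Fact sub_alpha_even q u : u \in sub_gr q -> sub_alpha u \in sub_gr q.
Proof. exact: alpha_even. Qed.

Fact sub_alpha_mult x : sub_alpha (sub_br x) = sub_br [ffun i => sub_alpha (x i)].
Proof. by apply: val_inj => /=; rewrite alpha_mult fam_val_alpha. Qed.

Fact sub_hom_nambu p q (x : {ffun 'I_n.-1 -> sI}) (y : {ffun 'I_n -> sI}) :
  homog_fam sub_gr p x -> homog_fam sub_gr q y ->
  sub_br (append [ffun i => sub_alpha (x i)] (sub_br y)) =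
  \sum_(i < n) (-1) ^+ ((\sum_(k < n.-1) p k) * par_before q i)%N *:
    sub_br (upd [ffun j => sub_alpha (y j)] i (sub_br (append x (y i)))).
Proof.
move=> /fam_val_homog hx /fam_val_homog hy.
apply: (@val_inj _ _ sI); rewrite [LHS]/= fam_val_append fam_val_alpha /=.
rewrite (hom_nambu hx hy) -[RHS]/(sub_val _) linear_sum; apply: eq_bigr => i _.
rewrite linearZ /= fam_val_upd fam_val_alpha /= fam_val_append.
by rewrite [fam_val y i]ffunE.
Qed.

Definition ideal_nambu : homNambu K n :=
  @HomNambu K n sI sub_gr sub_gr_dirsum sub_br sub_br_multilinear sub_br_even
    sub_alpha sub_alpha_even sub_alpha_mult sub_hom_nambu.

Fact sub_br_skew : skew_super ideal_nambu.
Proof.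
move=> p x i j /fam_val_homog hx ij; apply: (@val_inj _ _ sI).
rewrite -[LHS]/(br (fam_val x)) (br_skew hx ij) -[RHS]/(sub_val _).
rewrite [RHS]raddfN /=; congr (- (_ *: _)).
change (br (swap (fam_val x) i j) = br (fam_val (swap x i j))); congr br.
by apply/ffunP => k; rewrite !ffunE.
Qed.

Definition ideal_alg : homLie K n := HomLie sub_br_skew.

Definition ideal_val : ideal_alg -> N := @sub_val K N I.

(* The linear maps F on N = I (+) J with F (u + v) = f u for u in I, v in J and
   f ranging over S, i.e. the maps of S extended by zero on J. *)
Definition extend_by0 (J : submodClosed N) (S : set (ideal_alg -> ideal_alg)) :
    set (N -> N) :=
  [set F | exists2 f, S f & forall (u : ideal_alg) (v : N), v \in J ->
    F (ideal_val u + v) = ideal_val (f u)].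

End Restriction.

Arguments ideal_val {K n N I} hI _.
Arguments extend_by0 {K n N I hI} J S _.

(* Main.v *)
Require Import Defs.
From HB Require Import structures.
From mathcomp Require Import all_boot all_order all_fingroup all_algebra.
From mathcomp Require Import mathcomp_extra boolp classical_sets functions.

Set Implicit Arguments.
Unset Strict Implicit.
Unset Printing Implicit Defensive.

Import GRing.Theory.

Local Open Scope classical_set_scope.
Local Open Scope ring_scope.

(** An ideal absorbs brackets, so a bracket having an entry in [I] and an entry
in [J] lies in [I :&: J] and vanishes.  By multilinearity every bracket is then
the sum of the bracket of the [I]-components of its entries and the bracket of
the [J]-components ([br_split]): the algebra is the product of [I] and [J].
The projection onto [I] along [J] commutes with [alpha] and preserves the
grading, because [I] and [J] are graded and [alpha]-stable.

The statements on the center and on inner derivations are read off from this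
splitting: [z] is central iff both its components are ([center_dirsum]), and
[ad_X] is the sum of the extensions by zero of the [ad] of the two components
of [X] ([ad_split]).  Likewise the extension by zero of a derivation of [I] is
a derivation of the whole algebra ([extend_derivation]).

The main point is that, when the center is zero, a derivation [D] maps [I]
into itself ([derivation_ideal]).  For [u] in [I], let [b] be the [J]-component
of [D u]; it suffices that [b] be central.  By the splitting, the other entries
of a bracket containing [b] may be taken in [J], and as [alpha] is bijective
they may be written [alpha^k z_j] with [z_j] in [J].  The bracket of [u] with
the [z_j] is zero; applying [D] to it gives a sum in which every term but one
has the entry [alpha^k u] and hence is in [I].  The remaining term is the
bracket of [D u] with the [alpha^k z_j], where [D u] may be replaced by [b]
since [n >= 2] provides another entry, in [J], to kill its [I]-component.  It
is therefore in [I] as well as in [J], so it is zero.  Once [D] preserves both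
ideals, it is the sum of the extensions of its two restrictions.

For completeness, the decompositions of [Inn] and [Der] are compared.  Equality
of the summands gives equality of the sums, and conversely a summand can be
recovered from its sum, by restricting the maps to one ideal
([extend_dirsum_sub]). *)

(** * Linear spans, subspaces and projections *)

Section DirectSums.
Variables (K : fieldType) (W : lmodType K).

Lemma dirsumC (S U V : set W) : is_dirsum S U V -> is_dirsum S V U.
Proof.
move=> [-> cap0]; split; last by rewrite setIC.
by apply/seteqP; split=> _ [u Uu [v Vv <-]]; exists v => //; exists u => //;
  rewrite addrC.
Qed.

Lemma linspan_gen (S : set W) w : S w -> linspan S w.
Proof.
move=> Sw; exists 1%N, (fun=> 1), (fun=> w); split=> //.
by rewrite big_ord1 scale1r.
Qed.

Lemma linspan0 (S : set W) : linspan S 0.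
Proof.
exists 0%N, (fun=> 0), (fun=> 0); split; first by case.
by rewrite big_ord0.
Qed.

Lemma linspanD (S : set W) u v :
  linspan S u -> linspan S v -> linspan S (u + v).
Proof.
move=> [m [c [s [Ss ->]]]] [m' [c' [s' [Ss' ->]]]].
pose glue T (a : 'I_m -> T) (b : 'I_m' -> T) (i : 'I_(m + m')) :=
  match fintype.split i with inl j => a j | inr j => b j end.
exists (m + m')%N, (glue _ c c'), (glue _ s s'); split.
  by move=> i; rewrite /glue; case: fintype.split.
rewrite big_split_ord /glue; congr (_ + _); apply: eq_bigr => i _.
  by rewrite (unsplitK (inl i)).
by rewrite (unsplitK (inr i)).
Qed.

Lemma linspanZ (S : set W) a w : linspan S w -> linspan S (a *: w).
Proof.
move=> [m [c [s [Ss ->]]]]; exists m, (fun i => a * c i), s; split=> //.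
by rewrite scaler_sumr; apply: eq_bigr => i _; rewrite scalerA.
Qed.

Lemma linspan_sumZ (S : set W) m (c : 'I_m -> K) (s : 'I_m -> W) :
  (forall i, linspan S (s i)) -> linspan S (\sum_i c i *: s i).
Proof.
move=> Ss; apply: (big_ind (linspan S)); [exact: linspan0|exact: linspanD|].
by move=> i _; exact: linspanZ.
Qed.

Lemma submodN (U : submodClosed W) u : u \in U -> - u \in U.
Proof. by move=> Uu; rewrite -scaleN1r rpredZ. Qed.

Lemma submodB (U : submodClosed W) u v : u \in U -> v \in U -> u - v \in U.
Proof. by move=> Uu Uv; rewrite rpredD // submodN. Qed.

Lemma submodZsign (U : submodClosed W) m u :
  ((-1) ^+ m *: u \in U) = (u \in U).
Proof.
apply/idP/idP => [Us|]; last exact: rpredZ.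
by rewrite -[u]scale1r -(signrMK m 1) mulr1 -scalerA rpredZ.
Qed.

Section Projection.
Variables U V : submodClosed W.
Hypothesis hUV : is_dirsum [set: W] [set` U] [set` V].

Lemma dirsum_cap w : w \in U -> w \in V -> w = 0.
Proof.
by case: hUV => _ cap0 Uw Vw; have /= : [set 0 : W] w by rewrite -cap0.
Qed.

Lemma dirsum_decomp w : exists u, u \in U /\ w - u \in V.
Proof.
have [+ _] := hUV => /seteqP [/(_ w I) [u /= Uu [v /= Vv <-]] _].
by exists u; rewrite addrAC subrr add0r.
Qed.

(** The projection onto [U] along [V]. *)
Definition proj w := projT1 (cid (dirsum_decomp w)).

Lemma proj_in w : proj w \in U.
Proof. by rewrite /proj; case: cid => u []. Qed.

Lemma proj_compl w : w - proj w \in V.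
Proof. by rewrite /proj; case: cid => u []. Qed.

Lemma proj_uniq w u : u \in U -> w - u \in V -> proj w = u.
Proof.
move=> Uu Vu; apply/eqP; rewrite -subr_eq0; apply/eqP/dirsum_cap.
  exact: (submodB (proj_in w)).
have -> : proj w - u = (w - u) - (w - proj w).
  by rewrite opprB [RHS]addrC addrA subrK.
by rewrite submodB // proj_compl.
Qed.

Lemma proj_id u : u \in U -> proj u = u.
Proof. by move=> Uu; apply: proj_uniq; rewrite // subrr rpred0. Qed.

Lemma proj_eq0 v : v \in V -> proj v = 0.
Proof. by move=> Vv; apply: proj_uniq; rewrite ?subr0 ?rpred0. Qed.

Lemma proj_is_linear : linear proj.
Proof.
move=> a w w'; apply: proj_uniq.
  by rewrite rpredD ?rpredZ ?proj_in.
rewrite opprD addrACA -scalerBr.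
by rewrite rpredD ?rpredZ ?proj_compl.
Qed.

HB.instance Definition _ :=
  GRing.isLinear.Build K W W *:%R proj proj_is_linear.

Lemma proj_comm (f : {linear W -> W}) w :
  (forall u, u \in U -> f u \in U) -> (forall v, v \in V -> f v \in V) ->
  proj (f w) = f (proj w).
Proof.
move=> fU fV; apply: proj_uniq; first by rewrite fU ?proj_in.
by rewrite -linearB fV ?proj_compl.
Qed.

(** Membership in a summand is reflected because [f] commutes with the
projection, and elements of [U] are its fixed points.  Used for the inverse of
[alpha], both on the ideals and on the grading. *)
Lemma dirsum_reflect (f : {linear W -> W}) w : injective f ->
  (forall u, u \in U -> f u \in U) -> (forall v, v \in V -> f v \in V) ->
  f w \in U -> w \in U.
Proof.
move=> f_inj fU fV Ufw; suff <- : proj w = w by exact: proj_in.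
by apply: f_inj; rewrite -proj_comm // proj_id.
Qed.

End Projection.

Lemma proj_sum (U V : submodClosed W)
    (hUV : is_dirsum [set: W] [set` U] [set` V]) w :
  proj hUV w + proj (dirsumC hUV) w = w.
Proof.
rewrite [proj (dirsumC hUV) w](@proj_uniq _ _ _ _ (w - proj hUV w)).
- by rewrite addrC subrK.
- exact: proj_compl.
by rewrite opprB addrC subrK proj_in.
Qed.

End DirectSums.

(** * Multilinear maps *)

Section Multilinear.
Variables (K : fieldType) (n : nat) (V : lmodType K).
Variable f : {ffun 'I_n -> V} -> V.
Hypothesis f_multi : multilinear f.
Implicit Type x : {ffun 'I_n -> V}.

Lemma upd_id x i : upd x i (x i) = x.
Proof. by apply/ffunP => j; rewrite ffunE; case: eqP => // ->. Qed.

Lemma multilinearD x i u v :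
  f (upd x i (u + v)) = f (upd x i u) + f (upd x i v).
Proof. by have := f_multi x i 1 u v; rewrite !scale1r. Qed.

Lemma multilinear0 x i : x i = 0 -> f x = 0.
Proof.
move=> xi0; rewrite -(upd_id x i) xi0; have := multilinearD x i 0 0.
by rewrite addr0 => /eqP; rewrite -subr_eq subrr => /eqP.
Qed.

(** A multilinear map may be tested on families whose entries come from
generating sets [A i], which may depend on the position.  Sums of two
generators are enough for decompositions along [I] and [J] or along the
grading; entries are split one position at a time. *)
Lemma multilinear_ext0 (A B : 'I_n -> V -> Prop) :
  (forall i w, B i w -> exists u v, [/\ A i u, A i v & w = u + v]) ->
  (forall x, (forall i, A i (x i)) -> f x = 0) ->
  forall x, (forall i, B i (x i)) -> f x = 0.
Proof.
move=> BA fA0 x Bx.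
suff gen : forall s : seq 'I_n, uniq s -> forall y : {ffun 'I_n -> V},
    (forall i, i \in s -> B i (y i)) -> (forall i, i \notin s -> A i (y i)) ->
    f y = 0.
  apply: (gen (enum 'I_n) (enum_uniq _)) => i; first by [].
  by rewrite mem_enum.
elim=> [|i s IHs] /=; first by move=> _ y _ Ay; apply: fA0 => i; exact: Ay.
move=> /andP[i_s s_uniq] y By Ay.
have [u [v [Au Av yiE]]] := BA i (y i) (By i (mem_head i s)).
have step w : A i w -> f (upd y i w) = 0.
  move=> Aw; apply: (IHs s_uniq) => j.
    move=> js; rewrite ffunE; case: eqP => [ji|_].
      by rewrite -ji js in i_s.
    by apply: By; rewrite inE js orbT.
  move=> js; rewrite ffunE; case: eqP => [->//|/eqP ji].
  by apply: Ay; rewrite inE negb_or ji.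
by rewrite -(upd_id y i) yiE multilinearD !step // addr0.
Qed.

End Multilinear.

Lemma ord_other n (i : 'I_n) : (2 <= n)%N -> exists j : 'I_n, j != i.
Proof.
case: n i => [|[|n]] // i _.
by have [->|i0] := eqVneq i ord0; [exists (lift ord0 ord0) | exists ord0;
  rewrite eq_sym].
Qed.

Lemma append_lt (K : fieldType) n (V : lmodType K) (x : {ffun 'I_n.-1 -> V}) y
    (i : 'I_n) (j : 'I_n.-1) : i = j :> nat -> append x y i = x j.
Proof. by move=> ij; rewrite ffunE (ij : val i = val j) valK. Qed.

Lemma append_map (K : fieldType) n (V W : lmodType K) (h : V -> W)
    (x : {ffun 'I_n.-1 -> V}) y :
  [ffun i => h (append x y i)] = append [ffun i => h (x i)] (h y)
    :> {ffun 'I_n -> W}.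
Proof.
by apply/ffunP => i; rewrite !ffunE; case: insub => //= j; rewrite ffunE.
Qed.

(** * Ideals as algebras *)

Section IterAlpha.
Variables (K : fieldType) (n : nat) (N : homNambu K n).

Lemma iter_alpha_ideal k (I : submodClosed N) u :
  Hom_ideal I -> u \in I -> iter k (alpha N) u \in I.
Proof. by move=> hI Iu; elim: k => //= k; exact: ideal_alpha. Qed.

Lemma alpha_gr_reflect q u :
  injective (alpha N) -> alpha N u \in gr N q -> u \in gr N q.
Proof.
move=> a_inj; case: q; [apply: (dirsum_reflect (dirsumC (gr_dirsum N)))|
  apply: (dirsum_reflect (gr_dirsum N))] => //; exact: alpha_even.
Qed.

End IterAlpha.

Section IdealVal.
Variables (K : fieldType) (n : nat) (N : homLie K n).
Variables (I : submodClosed N) (hI : Hom_ideal I).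
Local Notation gI := (ideal_alg hI).
Local Notation iv := (ideal_val hI).

Lemma ideal_val_inj : injective iv.
Proof. exact: val_inj. Qed.

Lemma ideal_val_in u : iv u \in I.
Proof. exact: sub_valP. Qed.

Lemma ideal_val_linear : linear iv.
Proof. by []. Qed.

HB.instance Definition _ :=
  GRing.isLinear.Build K gI N *:%R iv ideal_val_linear.

Lemma ideal_val_sumZ m (c : 'I_m -> K) (u : 'I_m -> gI) :
  iv (\sum_i c i *: u i) = \sum_i c i *: iv (u i).
Proof. by rewrite linear_sum; apply: eq_bigr => i _; rewrite linearZZ. Qed.

Lemma ideal_val_gr q u : (u \in gr gI q) = (iv u \in gr N q).
Proof. by []. Qed.

Lemma ideal_val_alpha u : iv (alpha gI u) = alpha N (iv u).
Proof. by []. Qed.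

Lemma ideal_val_iter k u : iv (iter k (alpha gI) u) = iter k (alpha N) (iv u).
Proof. by elim: k => // k IHk; rewrite !iterS ideal_val_alpha IHk. Qed.

Lemma ideal_val_br (x : {ffun 'I_n -> gI}) :
  iv (br x) = br [ffun i => iv (x i)].
Proof. by []. Qed.

Lemma ideal_val_upd (x : {ffun 'I_n -> gI}) i u :
  [ffun j => iv (upd x i u j)] = upd [ffun j => iv (x j)] i (iv u).
Proof. exact: fam_val_upd. Qed.

End IdealVal.

(** * Two complementary ideals *)

Section IdealPair.
Variables (K : fieldType) (n : nat) (N : homLie K n) (I J : submodClosed N).
Hypotheses (hI : Hom_ideal I) (hJ : Hom_ideal J).
Hypothesis hIJ : is_dirsum [set: N] [set` I] [set` J].
Local Notation gI := (ideal_alg hI).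
Local Notation iv := (ideal_val hI).
Local Notation pI := (proj hIJ).
Local Notation pJ := (proj (dirsumC hIJ)).

Lemma br_mixed (x : {ffun 'I_n -> N}) i j : x i \in I -> x j \in J -> br x = 0.
Proof.
move=> Ix Jx; apply: (dirsum_cap hIJ); first exact: ideal_absorb Ix.
exact: ideal_absorb Jx.
Qed.

Lemma proj_alpha u : pI (alpha N u) = alpha N (pI u).
Proof. by apply: proj_comm => v; apply: ideal_alpha. Qed.

Lemma proj_iter k u : pI (iter k (alpha N) u) = iter k (alpha N) (pI u).
Proof. by elim: k => //= k IHk; rewrite proj_alpha IHk. Qed.

(** Writing the components of [u] in [I] and [J] as sums of homogeneous
elements of [I] and [J], the part of [u] of the wrong parity is a sum of an
element of [I] and one of [J]; it is zero, hence so are both of these. *)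
Lemma proj_gr q u : u \in gr N q -> pI u \in gr N q.
Proof.
move=> gu.
have [a0 [a1 [Ia0 ga0 Ia1 ga1 aE]]] := ideal_graded hI (proj_in hIJ u).
have [b0 [b1 [Jb0 gb0 Jb1 gb1 bE]]] :=
  ideal_graded hJ (proj_in (dirsumC hIJ) u).
have uE : u = (a0 + b0) + (a1 + b1) by rewrite addrACA -aE -bE proj_sum.
have c0 : a0 + b0 \in gr N false by rewrite rpredD.
have c1 : a1 + b1 \in gr N true by rewrite rpredD.
have indep a b : a \in I -> b \in J -> a + b = 0 -> a = 0.
  move=> Ia Jb ab0; apply: (dirsum_cap hIJ) => //.
  by move/eqP: ab0; rewrite addr_eq0 => /eqP ->; rewrite submodN.
case: q gu => gu; rewrite aE.
  suff -> : a0 = 0 by rewrite add0r.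
  apply: (indep _ b0) => //; apply: (dirsum_cap (gr_dirsum N)) => //.
  have -> : a0 + b0 = u - (a1 + b1) by rewrite uE addrK.
  by rewrite submodB.
suff -> : a1 = 0 by rewrite addr0.
apply: (indep _ b1) => //; apply: (dirsum_cap (gr_dirsum N)) => //.
have -> : a1 + b1 = u - (a0 + b0) by rewrite uE addrAC subrr add0r.
by rewrite submodB.
Qed.

Hypothesis n_ge2 : (2 <= n)%N.

(** The difference of both sides is multilinear in [x], so the entries of [x]
may be assumed to lie in [I] or in [J].  If they all lie in the same ideal one
of the brackets on the right has a zero entry and the other is [br x]; if not,
all three brackets vanish. *)
Lemma br_split (x : {ffun 'I_n -> N}) :
  br x = br [ffun i => pI (x i)] + br [ffun i => pJ (x i)].
Proof.
pose f (y : {ffun 'I_n -> N}) :=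
  br y - br [ffun i => pI (y i)] - br [ffun i => pJ (y i)].
have upd_map (h : N -> N) (y : {ffun 'I_n -> N}) i w :
    [ffun j => h (upd y i w j)] = upd [ffun j => h (y j)] i (h w).
  by apply/ffunP => j; rewrite !ffunE; case: eqP.
have f_multi : multilinear f.
  move=> y i a u v; rewrite /f !upd_map !linearP !br_multilinear.
  by rewrite !scalerBr !opprD [X in X + _ = _]addrACA [LHS]addrACA.
have i0 : 'I_n by case: (n) n_ge2 => // m _; exact: ord0.
suff : f x = 0 by move/eqP; rewrite /f -addrA -opprD subr_eq0 => /eqP.
apply: (multilinear_ext0 f_multi (A := fun _ w => w \in I \/ w \in J)
  (B := fun _ _ => True)) => //.
  move=> _ w _; exists (pI w), (pJ w); split; last by rewrite proj_sum.
    by left; exact: proj_in.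
  by right; exact: proj_in.
move=> y Ay; rewrite /f.
have brN0 (h : N -> N) i : h (y i) = 0 -> br [ffun i => h (y i)] = 0.
  by move=> hy0; apply: (multilinear0 (@br_multilinear _ _ N) (i := i));
    rewrite ffunE.
have [allI|] := pselect (forall i, y i \in I).
  rewrite (_ : [ffun i => pI (y i)] = y); last first.
    by apply/ffunP => i; rewrite ffunE proj_id.
  by rewrite (brN0 pJ i0) ?subrr ?subr0 // proj_eq0.
move=> /existsNP[i /negP yi]; have {yi} Jyi : y i \in J.
  by case: (Ay i) => // /idPn; rewrite yi.
rewrite (brN0 pI i) ?proj_eq0 // subr0.
have [allJ|] := pselect (forall i, y i \in J).
  rewrite (_ : [ffun i => pJ (y i)] = y) ?subrr //.
  by apply/ffunP => j; rewrite ffunE proj_id.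
move=> /existsNP[j /negP yj]; have {yj} Iyj : y j \in I.
  by case: (Ay j) => // /idPn; rewrite yj.
by rewrite (brN0 pJ j) ?proj_eq0 // (br_mixed Iyj Jyi) subr0.
Qed.

Lemma br_in_ideal (x : {ffun 'I_n -> N}) i :
  x i \in I -> br x = br [ffun i => pI (x i)].
Proof.
move=> Ixi; rewrite br_split.
rewrite [X in _ + X](multilinear0 (@br_multilinear _ _ N) (i := i)).
  by rewrite addr0.
by rewrite ffunE proj_eq0.
Qed.

Lemma proj_br (x : {ffun 'I_n -> N}) : pI (br x) = br [ffun i => pI (x i)].
Proof.
rewrite br_split linearD /= proj_id; last first.
  by apply: (ideal_br hI) => i; rewrite ffunE proj_in.
rewrite proj_eq0 ?addr0 //; apply: (ideal_br hJ) => i; rewrite ffunE.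
exact: proj_in.
Qed.

Definition ideal_proj (w : N) : gI := SubOf (proj_in hIJ w).

Lemma ideal_projK w : iv (ideal_proj w) = pI w.
Proof. by []. Qed.

Lemma ideal_valK u : ideal_proj (iv u) = u.
Proof.
by apply: ideal_val_inj; rewrite ideal_projK proj_id // ideal_val_in.
Qed.

Lemma ideal_proj_linear : linear ideal_proj.
Proof.
by move=> a u v; apply: ideal_val_inj; rewrite linearP !ideal_projK linearP.
Qed.
HB.instance Definition _ :=
  GRing.isLinear.Build K N gI *:%R ideal_proj ideal_proj_linear.

(** * Centers *)

Lemma center_val u : center gI u -> center N (iv u).
Proof.
move=> Cu i _ x.
rewrite (@br_in_ideal _ i) ?ffunE ?eqxx ?ideal_val_in //.
have := Cu i Logic.I [ffun j => ideal_proj (x j)].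
move=> /(congr1 iv); rewrite ideal_val_br ideal_val_upd linear0 => <-.
congr br; apply/ffunP => j; rewrite !ffunE; case: eqP => // _.
by rewrite proj_id ?ideal_val_in.
Qed.

Lemma center_proj w : center N w -> center gI (ideal_proj w).
Proof.
move=> Cw i _ x; apply: ideal_val_inj.
rewrite ideal_val_br ideal_val_upd linear0 ideal_projK.
have /(congr1 pI) := Cw i Logic.I [ffun j => iv (x j)].
rewrite proj_br linear0 => <-; congr br; apply/ffunP => j; rewrite !ffunE.
by case: eqP => // _; rewrite proj_id ?ideal_val_in.
Qed.

(** * Extension by zero *)

Definition extend (f : gI -> gI) : N -> N := fun w => iv (f (ideal_proj w)).

Lemma extend_by0E (S : set (gI -> gI)) : extend_by0 J S = extend @` S.
Proof.
apply/seteqP; split=> [F [f Sf Ff]|_ [f Sf <-]]; exists f => //.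
  apply/funext => w; rewrite /extend -(Ff _ (pJ w)) ?proj_in //.
  by rewrite ideal_projK proj_sum.
move=> u v Jv; rewrite /extend; congr (iv (f _)).
by apply: ideal_val_inj; rewrite ideal_projK linearD /= proj_id
  ?ideal_val_in // proj_eq0 ?addr0.
Qed.

Lemma extend_linear : linear extend.
Proof. by move=> a f f'; apply/funext => w; rewrite /extend linearP. Qed.
HB.instance Definition _ :=
  GRing.isLinear.Build K (gI -> gI) (N -> N) *:%R extend extend_linear.

Lemma extend_val f u : extend f (iv u) = iv (f u).
Proof. by rewrite /extend ideal_valK. Qed.

(** * Inner derivations *)

Lemma extend_ad_proj k (x : {ffun 'I_n.-1 -> N}) w :
  extend (ad k [ffun i => ideal_proj (x i)]) w =
  br [ffun i => pI (append x (iter k (alpha N) w) i)].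
Proof.
rewrite /extend /ad ideal_val_br !append_map ideal_val_iter ideal_projK.
rewrite proj_iter; congr (br (append _ _)); apply/ffunP => i.
by rewrite !ffunE.
Qed.

(** Extending by zero amounts to taking brackets in [N], because [n >= 2] leaves
at least one entry of [x], in [I], to kill the [J]-component of the argument. *)
Lemma extend_ad k (x : {ffun 'I_n.-1 -> gI}) :
  extend (ad k x) = ad k [ffun i => iv (x i)].
Proof.
have {1}-> : x = [ffun i => ideal_proj ([ffun i => iv (x i)] i)].
  by apply/ffunP => i; rewrite !ffunE ideal_valK.
apply/funext => w; rewrite extend_ad_proj /ad.
have lt0 : (0 < n.-1)%N by case: (n) n_ge2 => [|[]].
rewrite [RHS](@br_in_ideal _ (Ordinal (ltnW n_ge2))) //.
by rewrite (append_lt _ _ (j := Ordinal lt0)) // ffunE ideal_val_in.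
Qed.

Lemma extend_inn k f : Inn gI k f -> Inn N k (extend f).
Proof.
move=> [m [c [s [Ss ->]]]]; exists m, c, (extend \o s); split; last first.
  by rewrite linear_sum; apply: eq_bigr => i _; rewrite linearZ.
move=> i; have [x [xg xfix sE]] := Ss i; exists [ffun i => iv (x i)].
split; last by rewrite -extend_ad -sE.
  by move=> j; have [q xq] := xg j; exists q; rewrite ffunE.
by move=> j; rewrite ffunE -ideal_val_alpha xfix.
Qed.

Lemma inn_proj (x : {ffun 'I_n.-1 -> N}) k :
  (forall i, exists q, x i \in gr N q) -> (forall i, alpha N (x i) = x i) ->
  Inn gI k (ad k [ffun i => ideal_proj (x i)]).
Proof.
move=> xg xfix; apply: linspan_gen; exists [ffun i => ideal_proj (x i)].
split=> // i; rewrite ffunE.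
  by have [q xq] := xg i; exists q; rewrite ideal_val_gr ideal_projK proj_gr.
by apply: ideal_val_inj; rewrite ideal_val_alpha ideal_projK -proj_alpha xfix.
Qed.

(** * Derivations *)

Lemma extend_derivation k d f :
  is_derivation (N := gI) k d f -> is_derivation k d (extend f).
Proof.
move=> [f_lin f_par f_alpha f_br]; split.
- by move=> a u v; rewrite /extend linearP f_lin linearP.
- by move=> q u gu; apply: f_par; rewrite ideal_val_gr ideal_projK proj_gr.
- move=> u; rewrite /extend -ideal_val_alpha -f_alpha; congr (iv (f _)).
  by apply: ideal_val_inj; rewrite ideal_val_alpha !ideal_projK proj_alpha.
move=> p x gx; rewrite /extend.
have -> : ideal_proj (br x) = br [ffun i => ideal_proj (x i)].
  apply: ideal_val_inj; rewrite ideal_projK proj_br ideal_val_br.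
  by congr br; apply/ffunP => i; rewrite !ffunE.
rewrite (f_br p); last first.
  by move=> i; rewrite ffunE ideal_val_gr ideal_projK proj_gr.
rewrite ideal_val_sumZ; apply: eq_bigr => i _; congr (_ *: _).
rewrite ideal_val_br ideal_val_upd [RHS](@br_in_ideal _ i); last first.
  by rewrite ffunE eqxx ideal_val_in.
congr br; apply/ffunP => j; rewrite !ffunE; case: eqP => [_|_].
  by rewrite proj_id ?ideal_val_in.
by rewrite ideal_val_iter ideal_projK proj_iter.
Qed.

Lemma extend_der k f : Der gI k f -> Der N k (extend f).
Proof.
move=> [f0 df0 [f1 df1 <-]]; exists (extend f0); first exact: extend_derivation.
by exists (extend f1); [exact: extend_derivation|rewrite linearD].
Qed.

Lemma restrict_derivation k d D : is_derivation k d D ->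
  (forall u, u \in I -> D u \in I) ->
  is_derivation (N := gI) k d (fun u => ideal_proj (D (iv u))).
Proof.
move=> [D_lin D_par D_alpha D_br] DI.
have valD u : iv (ideal_proj (D (iv u))) = D (iv u).
  by rewrite ideal_projK proj_id // DI // ideal_val_in.
split.
- by move=> a u v; apply: ideal_val_inj; rewrite !linearP D_lin linearP.
- by move=> q u gu; have Du := D_par q (iv u) gu; rewrite -valD in Du.
- by move=> u; apply: ideal_val_inj; rewrite valD !ideal_val_alpha valD D_alpha.
move=> p x gx; apply: ideal_val_inj; rewrite valD ideal_val_br (D_br p).
  rewrite ideal_val_sumZ; apply: eq_bigr => i _; congr (_ *: _).
  rewrite ideal_val_br ideal_val_upd valD ffunE; congr (br (upd _ _ _)).
  by apply/ffunP => j; rewrite !ffunE ideal_val_iter.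
by move=> i; rewrite ffunE; exact: gx.
Qed.

Hypothesis alpha_bij : bijective (alpha N).

(** The law of [alpha^k]-derivations only yields brackets whose entries, but for
one, are images under [alpha^k]; in [J], this is no restriction on homogeneous
entries. *)
Lemma iter_alpha_preim k q y : y \in J -> y \in gr N q ->
  exists z, [/\ z \in J, z \in gr N q & iter k (alpha N) z = y].
Proof.
have a_inj := bij_inj alpha_bij; have [b _ bK] := alpha_bij.
elim: k y => [|k IHk] y Jy gy; first by exists y.
have Jb : b y \in J.
  apply: (dirsum_reflect (dirsumC hIJ) (f := alpha N)) => //;
    last by rewrite bK.
    by move=> u; apply: ideal_alpha.
  by move=> u; apply: ideal_alpha.
have gb : b y \in gr N q by apply: alpha_gr_reflect; rewrite ?bK.
by have [z [Jz gz zE]] := IHk _ Jb gb; exists z; rewrite /= zE bK.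
Qed.

(** Applying [D] to vanishing brackets of [u] in [I] with elements of [J] shows
that the [J]-component of [D u] is central, hence zero. *)
Lemma derivation_ideal k d D : center N = [set 0] -> is_derivation k d D ->
  forall u, u \in I -> D u \in I.
Proof.
move=> C0 [D_lin D_par D_alpha D_br].
have D0 : D 0 = 0.
  by have := D_lin (-1) 0 0; rewrite scaler0 addr0 scaleN1r addNr.
have DD u v : D (u + v) = D u + D v.
  by have := D_lin 1 u v; rewrite !scale1r.
(* The derivation law applies to homogeneous elements only. *)
suff homog u q : u \in I -> u \in gr N q -> D u \in I.
  move=> u /(ideal_graded hI)[u0 [u1 [I0 g0 I1 g1 ->]]].
  by rewrite DD rpredD // (homog _ _ _ g0, homog _ _ _ g1).
move=> Iu gu; suff pJ0 : pJ (D u) = 0.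
  by rewrite -(proj_sum hIJ (D u)) pJ0 addr0 proj_in.
set b := pJ (D u); have Jb : b \in J by exact: proj_in.
suff : center N b by rewrite C0.
have br0 := multilinear0 (@br_multilinear _ _ N).
move=> i _ x.
have -> : br (upd x i b) = br (upd [ffun j => pJ (x j)] i b).
  rewrite br_split [X in X + _](br0 _ i) ?add0r; last first.
    by rewrite !ffunE eqxx proj_eq0.
  congr br; apply/ffunP => j; rewrite !ffunE.
  by case: eqP => // _; rewrite proj_id.
(* The entry at [i] is fixed to [b]; the decomposition [b = b + 0] lets it take
   part in the reduction of the other entries to homogeneous elements of [J]. *)
apply: (multilinear_ext0 (@br_multilinear _ _ N)
  (B := fun j w => w \in J /\ (j = i -> w = b))
  (A := fun j w => if j == i then w = b \/ w = 0
                   else w \in J /\ exists q, w \in gr N q)).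
- move=> j w [Jw wE]; case: eqP => [ji|_].
    by exists b, 0; rewrite addr0 wE //; split; [left|right|].
  have [w0 [w1 [J0 g0 J1 g1 ->]]] := ideal_graded hJ Jw.
  by exists w0, w1; split=> //; split=> //; [exists false | exists true].
- move=> {}x Ax; have := Ax i; rewrite eqxx => -[xi|/br0//].
  have /fin_all_exists[z zP] j : exists z, [/\ exists q, z \in gr N q,
      j = i -> z = u & j != i -> z \in J /\ iter k (alpha N) z = x j].
    have := Ax j; case: eqP => [->|/eqP ji [Jx [q' gx]]].
      by exists u; split=> //; exists q.
    have [z [Jz gz zE]] := iter_alpha_preim k Jx gx.
    by exists z; split=> //; [exists q' | move/eqP; rewrite (negPf ji)].
  have /fin_all_exists[p pP] j : exists q, z j \in gr N q by case: (zP j).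
  have zi : z i = u by case: (zP i) => _ ->.
  have zJ j : j != i -> z j \in J by case: (zP j) => _ _ H /H[].
  pose zf : {ffun 'I_n -> N} := [ffun j => z j].
  have zgr : homog_fam (gr N) p zf by move=> j; rewrite ffunE.
  have [j0 j0i] := ord_other i n_ge2.
  have brz : br zf = 0.
    by apply: (@br_mixed _ i j0); rewrite ffunE ?zi ?zJ.
  (* Among the terms of the derivation law at [zf], only the [i]-th one does not
     contain the entry [alpha^k u]. *)
  have := D_br p zf zgr; rewrite brz D0 (bigD1 i) //=.
  set y := [ffun j => _]; rewrite ffunE zi => /esym/eqP.
  rewrite addr_eq0 => /eqP tE.
  have It : br (upd y i (D u)) \in I.
    rewrite -(submodZsign _ (d * par_before p i)) tE submodN //.
    rewrite rpred_sum // => j ji.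
    rewrite submodZsign; apply: (ideal_absorb hI (i := i)).
    by rewrite !ffunE eq_sym (negPf ji) zi iter_alpha_ideal.
  have xE : upd y i b = x.
    apply/ffunP => j; rewrite !ffunE; case: eqP => [->//|/eqP ji].
    by have [_ _ /(_ ji) []] := zP j.
  apply: (dirsum_cap hIJ);
    last by apply: (ideal_absorb hJ (i := i)); rewrite xi.
  move: It; rewrite -{1}(proj_sum hIJ (D u)).
  rewrite (multilinearD (@br_multilinear _ _ N)) -/b xE.
  rewrite (@br_mixed (upd _ _ _) i j0) ?add0r //.
    by rewrite ffunE eqxx proj_in.
  rewrite !ffunE (negPf j0i); apply: iter_alpha_ideal => //.
  exact: zJ.
by move=> j; rewrite !ffunE; case: eqP => ji; split=> //; exact: proj_in.
Qed.

End IdealPair.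

(** * The space of derivations *)

Section DerSpace.
Variables (K : fieldType) (n : nat) (N : homNambu K n).

Lemma derivation0 k d : is_derivation (N := N) k d 0.
Proof.
split=> [a u v|q u _|u|p x _]; rewrite ?scaler0 ?addr0 ?rpred0 ?linear0 //.
rewrite big1 // => i _.
rewrite (multilinear0 (@br_multilinear _ _ N) (i := i)) ?scaler0 //.
by rewrite ffunE eqxx.
Qed.

Lemma derivationD k d (D D' : N -> N) :
  is_derivation k d D -> is_derivation k d D' -> is_derivation k d (D + D').
Proof.
move=> [D_lin D_par D_alpha D_br] [D_lin' D_par' D_alpha' D_br']; split.
- by move=> a u v; rewrite !fctE D_lin D_lin' scalerDr addrACA.
- by move=> q u gu; rewrite fctE rpredD ?D_par ?D_par'.
- by move=> u; rewrite !fctE D_alpha D_alpha' linearD.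
move=> p x gx; rewrite fctE (D_br p) // (D_br' p) // -big_split /=.
apply: eq_bigr => i _; rewrite -scalerDr -multilinearD //.
exact: br_multilinear.
Qed.

Lemma Der0 k : Der N k 0.
Proof.
by exists 0; [exact: derivation0|exists 0; [exact: derivation0|rewrite addr0]].
Qed.

Lemma DerD k D D' : Der N k D -> Der N k D' -> Der N k (D + D').
Proof.
move=> [D0 dD0 [D1 dD1 <-]] [D0' dD0' [D1' dD1' <-]].
exists (D0 + D0'); first exact: derivationD.
by exists (D1 + D1'); [exact: derivationD|rewrite addrACA].
Qed.

End DerSpace.

(** * Decompositions *)

Section Decomposition.
Variables (K : fieldType) (n : nat) (N : homLie K n) (I J : submodClosed N).
Hypotheses (hI : Hom_ideal I) (hJ : Hom_ideal J).
Hypothesis hIJ : is_dirsum [set: N] [set` I] [set` J].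
Local Notation gI := (ideal_alg hI).
Local Notation gJ := (ideal_alg hJ).
Local Notation eI := (@extend _ _ _ _ _ hI hIJ).
Local Notation eJ := (@extend _ _ _ _ _ hJ (dirsumC hIJ)).
Local Notation qI := (ideal_proj hI hIJ).
Local Notation qJ := (ideal_proj hJ (dirsumC hIJ)).

(** A sum of spaces of extended maps is always direct: a map extended from both
ideals takes its values in [I :&: J], hence is zero. *)
Lemma extend_dirsum (S : set (N -> N)) (A : set (gI -> gI))
    (B : set (gJ -> gJ)) :
  A 0 -> B 0 -> (forall f f', A f -> B f' -> S (eI f + eJ f')) ->
  (forall F, S F -> exists f f', [/\ A f, B f' & F = eI f + eJ f']) ->
  is_dirsum S (extend_by0 J A) (extend_by0 I B).
Proof.
move=> A0 B0 AB SAB; rewrite (extend_by0E hIJ) (extend_by0E (dirsumC hIJ)).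
split; apply/seteqP; split.
- move=> F /SAB[f [f' [Af Bf' ->]]].
  by exists (eI f); [exists f|exists (eJ f') => //; exists f'].
- by move=> _ [_ [f Af <-] [_ [f' Bf' <-] <-]]; exact: AB.
- move=> F [[f _ fF] [f' _ f'F]]; apply/funext => w.
  apply: (dirsum_cap hIJ); first by rewrite -fF ideal_val_in.
  by rewrite -f'F ideal_val_in.
by move=> _ ->; split; exists 0; rewrite ?linear0.
Qed.

(** A summand is recovered from the sum by restriction to [I] followed by the
projection onto [I], which erases the maps extended from [J]. *)
Lemma extend_dirsum_sub S (A A' : set (gI -> gI)) (B B' : set (gJ -> gJ)) :
  is_dirsum S (extend_by0 J A) (extend_by0 I B) ->
  is_dirsum S (extend_by0 J A') (extend_by0 I B') -> A `<=` A'.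
Proof.
rewrite !(extend_by0E hIJ) !(extend_by0E (dirsumC hIJ)).
move=> [SAB /seteqP[_ /(_ 0 erefl) [_ B0]]] [SAB' _] f Af.
have : S (eI f).
  by rewrite SAB; exists (eI f); [exists f|exists 0; rewrite ?addr0].
rewrite SAB' => -[_ [f' Af' <-] [_ [h _ <-] fE]].
suff -> : f = f' by [].
apply/funext => u; have /(congr1 (fun F => qI (F (ideal_val hI u)))) := fE.
rewrite fctE linearD /= !extend_val !ideal_valK => <-.
rewrite -[RHS]addr0; congr (_ + _); apply: ideal_val_inj.
by rewrite linear0 ideal_projK proj_eq0 // ideal_val_in.
Qed.

Hypothesis n_ge2 : (2 <= n)%N.

Lemma center_dirsum :
  is_dirsum (center N) (ideal_val hI @` center gI) (ideal_val hJ @` center gJ).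
Proof.
have center0 : center N 0.
  by move=> i _ x; apply: (multilinear0 (@br_multilinear _ _ N) (i := i));
    rewrite ffunE eqxx.
split; apply/seteqP; split.
- move=> w Cw; exists (ideal_val hI (qI w)).
    by exists (qI w) => //; apply: center_proj.
  exists (ideal_val hJ (qJ w)); last by rewrite !ideal_projK proj_sum.
  by exists (qJ w) => //; apply: center_proj.
- move=> _ [_ [u Cu <-] [_ [v Cv <-] <-]] i _ x.
  rewrite (multilinearD (@br_multilinear _ _ N)).
  rewrite (center_val hJ hIJ n_ge2 Cu) //.
  by rewrite (center_val hI (dirsumC hIJ) n_ge2 Cv) // addr0.
- move=> w [[u _ uw] [v _ vw]]; apply: (dirsum_cap hIJ).
    by rewrite -uw ideal_val_in.
  by rewrite -vw ideal_val_in.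
move=> _ ->; split.
  by exists (qI 0); [apply: center_proj|rewrite !linear0].
by exists (qJ 0); [apply: center_proj|rewrite !linear0].
Qed.

Lemma ad_split k (x : {ffun 'I_n.-1 -> N}) :
  ad k x = eI (ad k [ffun i => qI (x i)]) + eJ (ad k [ffun i => qJ (x i)]).
Proof.
apply/funext => w; rewrite fctE (extend_ad_proj hI hJ) (extend_ad_proj hJ hI).
exact: br_split.
Qed.

Lemma inn_dirsum k :
  is_dirsum (Inn N k) (extend_by0 J (Inn gI k)) (extend_by0 I (Inn gJ k)).
Proof.
apply: extend_dirsum; [exact: linspan0|exact: linspan0| |].
  by move=> f f' Af Bf'; apply: linspanD; apply: extend_inn.
move=> _ [m [c [s [Ss ->]]]].
have /fin_all_exists[x xP] i := Ss i.
exists (\sum_i c i *: ad k [ffun j => qI (x i j)]).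
exists (\sum_i c i *: ad k [ffun j => qJ (x i j)]); split.
- apply: linspan_sumZ => i; have [xg xfix _] := xP i.
  exact: inn_proj.
- apply: linspan_sumZ => i; have [xg xfix _] := xP i.
  exact: inn_proj.
rewrite !linear_sum -big_split; apply: eq_bigr => i _ /=.
by rewrite !linearZZ -scalerDr -ad_split; have [_ _ ->] := xP i.
Qed.

Hypothesis alpha_bij : bijective (alpha N).

Lemma derivation_split k d D : center N = [set 0] -> is_derivation k d D ->
  exists f f', [/\ is_derivation (N := gI) k d f, is_derivation (N := gJ) k d f'
    & D = eI f + eJ f'].
Proof.
move=> C0 dD.
have DI := derivation_ideal hI hJ hIJ n_ge2 alpha_bij C0 dD.
have DJ := derivation_ideal hJ hI (dirsumC hIJ) n_ge2 alpha_bij C0 dD.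
exists (fun u => qI (D (ideal_val hI u))), (fun u => qJ (D (ideal_val hJ u))).
split; [exact: restrict_derivation|exact: restrict_derivation|].
apply/funext => w; rewrite fctE /extend !ideal_projK.
rewrite (proj_id hIJ (DI _ (proj_in hIJ w))).
rewrite (proj_id (dirsumC hIJ) (DJ _ (proj_in (dirsumC hIJ) w))).
rewrite -{1}(proj_sum hIJ w); case: dD => D_lin _ _ _.
by have := D_lin 1 (proj hIJ w) (proj (dirsumC hIJ) w); rewrite !scale1r.
Qed.

Lemma der_dirsum k : center N = [set 0] ->
  is_dirsum (Der N k) (extend_by0 J (Der gI k)) (extend_by0 I (Der gJ k)).
Proof.
move=> C0; apply: extend_dirsum; [exact: Der0|exact: Der0| |].
  by move=> f f' Af Bf'; apply: DerD; apply: extend_der.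
move=> _ [D0 dD0 [D1 dD1 <-]].
have [f0 [f0' [df0 df0' ->]]] := derivation_split C0 dD0.
have [f1 [f1' [df1 df1' ->]]] := derivation_split C0 dD1.
exists (f0 + f1), (f0' + f1'); split.
- by exists f0 => //; exists f1.
- by exists f0' => //; exists f1'.
by rewrite !linearD addrACA.
Qed.

Lemma complete_ideal : complete N -> complete gI.
Proof.
move=> [C0 DerInn]; split=> [|k].
  apply/seteqP; split=> [u /(center_val hJ hIJ n_ge2)|_ ->].
    by rewrite C0 => u0; apply: ideal_val_inj; rewrite linear0.
  have : center N 0 by rewrite C0.
  by move/(center_proj (hI := hI) hJ hIJ n_ge2); rewrite linear0.
have dI := inn_dirsum k; have dD := der_dirsum k.+1 C0.
rewrite DerInn in dD; apply/seteqP; split.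
  exact: extend_dirsum_sub dD dI.
exact: extend_dirsum_sub dI dD.
Qed.

Lemma complete_sum : complete gI -> complete gJ -> complete N.
Proof.
move=> [CI DI] [CJ DJ]; have C0 : center N = [set 0].
  have [-> _] := center_dirsum; rewrite CI CJ.
  apply/seteqP; split=> [_ [_ [_ -> <-] [_ [_ -> <-] <-]]|_ ->].
    by rewrite !linear0 addr0.
  exists 0; first by exists 0; rewrite ?linear0.
  by exists 0; [exists 0; rewrite ?linear0|rewrite addr0].
split=> // k; have [-> _] := der_dirsum k.+1 C0; have [-> _] := inn_dirsum k.
by rewrite DI DJ.
Qed.

End Decomposition.

Theorem theorem3p21 (K : fieldType) (charK0 : [pchar K] =i pred0)
    (n : nat) (n_ge2 : (2 <= n)%N) (g : homLie K n) (I J : submodClosed g)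
    (hI : Hom_ideal I) (hJ : Hom_ideal J)
    (gIJ : is_dirsum [set: g] [set` I] [set` J])
    (alpha_bij : bijective (alpha g)) :
  [/\ is_dirsum (center g)
        (ideal_val hI @` center (ideal_alg hI))
        (ideal_val hJ @` center (ideal_alg hJ)),
      center g = [set 0] -> forall k : nat,
        is_dirsum (Inn g k)
          (extend_by0 J (Inn (ideal_alg hI) k))
          (extend_by0 I (Inn (ideal_alg hJ) k)) /\
        is_dirsum (Der g k.+1)
          (extend_by0 J (Der (ideal_alg hI) k.+1))
          (extend_by0 I (Der (ideal_alg hJ) k.+1))
    & complete g <-> complete (ideal_alg hI) /\ complete (ideal_alg hJ)].
Proof.
split; first exact: center_dirsum.
  by move=> C0 k; split; [exact: inn_dirsum|exact: der_dirsum].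
split=> [cg|[cI cJ]]; last exact: (complete_sum gIJ).
by split; [exact: (complete_ideal hI hJ gIJ)|
           exact: (complete_ideal hJ hI (dirsumC gIJ))].
Qed.
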